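(* The unbiased one-sided transposition shuffle $\overline{\mathrm{OST}}_{n,0}$ on the hyperoctahedral group $B_n$ satisfies the following bounds for $c_1>0$, $c_2>2$: $$\limsup_{n\to\infty}\bigl\lVert\overline{\mathrm{OST}}_{n,0}^{\,n\log n+c_1n}-\pi_n\bigr\rVert_{\mathrm{Sep}}\le e^{-c_1},$$ $$\liminf_{n\to\infty}\bigl\lVert\overline{\mathrm{OST}}_{n,0}^{\,n\log n-n\log\log n-c_2n}-\pi_n\bigr\rVert_{\mathrm{TV}}\ge1-\frac{\pi^2}{6(c_2-2)^2}.$$ Thus, the unbiased one-sided transposition shuffle on $B_n$ exhibits a cutoff in total variation distance and in separation distance at time $n\log n$.
   Context: $B_n$ is the group (under composition) of all bijections $\sigma$ of $\{\pm1,\dots,\pm n\}$ with $\sigma(-i)=-\sigma(i)$, containing $S_n$ as those $\sigma$ with $\sigma(i)>0$ for $i>0$; $|B_n|=2^nn!$. $\xi_i\in B_n$ swaps $i$ and $-i$ and fixes all $j\ne\pm i$. $\overline{\mathrm{OST}}_{n,0}$ is the random walk on $B_n$ driven by the distribution: mass $\frac1{2n}\sum_{j=1}^n\frac1j$ on $e$; mass $\frac1{2nj}$ on $\xi_j$ for $1\le j\le n$; mass $\frac1{2nj}$ on each of $(i\,j)$ and $\xi_i\xi_j(i\,j)$ for $1\le i<j\le n$; $0$ elsewhere. $\pi_n$ is the uniform distribution on $B_n$. $P^t$ denotes the $t$-fold convolution of $P$ (law at time $t$ of the walk started from the identity); for a real $s\ge0$, $P^s$ means $P^{\lfloor s\rfloor}$.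 $\lVert\mu-\nu\rVert_{\mathrm{TV}}=\frac12\sum_g|\mu(g)-\nu(g)|$ and $\lVert P^t-\pi\rVert_{\mathrm{Sep}}=\max_h\bigl(1-\frac{P^t(h)}{\pi(h)}\bigr)$. A sequence $P_n$ with stationary distributions $\pi_n$ exhibits a cutoff at time $t_n$ in a distance $\lVert\cdot\rVert$ (TV or Sep) if there is a window $w_n=o(t_n)$ with $\lim_{c\to\infty}\limsup_{n\to\infty}\lVert P_n^{t_n+cw_n}-\pi_n\rVert=0$ and $\lim_{c\to\infty}\liminf_{n\to\infty}\lVert P_n^{t_n-cw_n}-\pi_n\rVert=1$. *)

(* Defs.v *)
From HB Require Import structures.
From mathcomp Require Import all_boot all_order all_algebra all_fingroup.
From mathcomp Require Import all_classical all_reals all_analysis.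
Import Order.TTheory GRing.Theory Num.Theory numFieldNormedType.Exports.

Set Implicit Arguments.
Unset Strict Implicit.
Unset Printing Implicit Defensive.

(* {±1, ..., ±n}: (false, i) stands for +(i+1) and (true, i) for -(i+1). *)
Definition signed (n : nat) : finType := (bool * 'I_n)%type.

Definition sneg (n : nat) (x : signed n) : signed n := (~~ x.1, x.2).

Section Hyperoctahedral.
Variable n : nat.
Local Open Scope group_scope.

Definition hyperoct_set : {set {perm signed n}} :=
  [set s : {perm signed n} | [forall x, s (sneg x) == sneg (s x)]].

Lemma hyperoctP (s : {perm signed n}) :
  reflect (forall x, s (sneg x) = sneg (s x)) (s \in hyperoct_set).
Proof.
rewrite inE; apply: (iffP forallP) => [h x|h x]; first exact/eqP.
by apply/eqP.
Qed.

Lemma hyperoct_group_set : group_set hyperoct_set.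
Proof.
apply/group_setP; split=> [|s u /hyperoctP hs /hyperoctP hu].
  by apply/hyperoctP => x; rewrite !perm1.
by apply/hyperoctP => x; rewrite !permM hs hu.
Qed.

Canonical hyperoct : {group {perm signed n}} := Group hyperoct_group_set.

Lemma signed_eqE (b c : bool) (i j : 'I_n) :
  ((b, i) == (c, j) :> signed n) = (b == c) && (i == j).
Proof. by []. Qed.

Lemma xi_subproof (i : 'I_n) :
  tperm ((false, i) : signed n) (true, i) \in hyperoct.
Proof.
apply/hyperoctP => -[b k]; rewrite /sneg !permE /= !signed_eqE.
by case: b; case: (k =P i) => //= ->.
Qed.

Lemma transp_subproof (i j : 'I_n) :
  tperm ((false, i) : signed n) (false, j) * tperm (true, i) (true, j)
    \in hyperoct.
Proof.
apply/hyperoctP => -[b k]; rewrite /sneg !permM !permE /= !signed_eqE.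
by case: b => /=; case: (k =P i) => ki; rewrite ?signed_eqE /=;
  case: (k =P j) => kj; rewrite ?signed_eqE /=; (do ?case: eqP => //=);
  congruence.
Qed.

End Hyperoctahedral.

Notation "''B_' n" := (subg_of (hyperoct n))
  (at level 8, n at level 2, format "''B_' n") : type_scope.

Definition xi (n : nat) (i : 'I_n) : 'B_n := Subg (xi_subproof i).

(* The image in B_n of the transposition (i j) of S_n: it exchanges i and j,
   and also -i and -j. *)
Definition transp (n : nat) (i j : 'I_n) : 'B_n := Subg (transp_subproof i j).

Local Open Scope classical_set_scope.
Local Open Scope ring_scope.

Section RandomWalk.
Variables (R : realType) (gT : finGroupType).
Implicit Types (P Q mu nu : gT -> R).

Definition dirac1 : gT -> R := fun g => (g == 1%g)%:R.

Definition unif : gT -> R := fun=> #|gT|%:R^-1.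

Definition convolution P Q : gT -> R :=
  fun g => \sum_(h : gT) P h * Q (h^-1 * g)%g.

Definition convpow P (t : nat) : gT -> R := iter t (convolution P) dirac1.

(* For s < 0 the truncation is 0. *)
Definition walk P (s : R) : gT -> R := convpow P (Num.truncn s).

Definition tv_dist mu nu : R := 2^-1 * \sum_(g : gT) `|mu g - nu g|.

(* Seeding the iterated max with the value at the identity makes it the exact
   maximum over the (nonempty) group. *)
Definition sep_dist mu nu : R :=
  \big[Num.max/1 - mu 1%g / nu 1%g]_(h : gT) (1 - mu h / nu h).

End RandomWalk.

Definition cutoff (R : realType)
    (dist : forall gT : finGroupType, (gT -> R) -> (gT -> R) -> R)
    (gT : nat -> finGroupType) (P pi_ : forall n, gT n -> R)
    (t : nat -> R) : Prop :=
  exists w : nat -> R,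
    [/\ w =o_\oo t,
        (fun c : R => limn_esup (fun n =>
           (dist (gT n) (walk (P n) (t n + c * w n)) (pi_ n))%:E))
          @ +oo --> 0%:E
      & (fun c : R => limn_einf (fun n =>
           (dist (gT n) (walk (P n) (t n - c * w n)) (pi_ n))%:E))
          @ +oo --> 1%:E].

(* The elements carrying mass are pairwise distinct, so the law is written as a
   sum of point masses; the index i : 'I_n stands for i+1, whence the i.+1. *)
Definition ost0 (R : realType) (n : nat) (g : 'B_n) : R :=
  (2 * n%:R)^-1 * (\sum_(j < n) j.+1%:R^-1) * (g == 1%g)%:R
  + \sum_(j < n) (2 * n%:R * j.+1%:R)^-1 * (g == xi j)%:R
  + \sum_(j < n) \sum_(i < n | (i < j)%N) (2 * n%:R * j.+1%:R)^-1 *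
      ((g == transp i j)%:R + (g == xi i * xi j * transp i j)%g%:R).

(* Main.v *)
Require Import Defs.
From HB Require Import structures.
From mathcomp Require Import all_boot all_order all_algebra all_fingroup.
From mathcomp Require Import all_classical all_reals all_analysis.
From mathcomp Require Import ring lra zify.
Import Order.TTheory GRing.Theory Num.Theory numFieldNormedType.Exports.
Local Open Scope classical_set_scope.
Local Open Scope ring_scope.

Set Implicit Arguments.
Unset Strict Implicit.
Unset Printing Implicit Defensive.

(* Given that the right hand chooses [j], a step multiplies by a uniform signed
   transposition of [j] with one of the signed positions up to [j]. These steps
   commute, since conjugation by an element fixing [j, ..., n - 1] permutes the
   signed transpositions of [j]; and the product of one step for each [j] is
   uniform, as in the Fisher-Yates shuffle. Hence the separation distance at
   time [t] is at most the probability [n (1 - 1/n)^t] that some [j] has not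
   been chosen.

   For the lower bound, count the cards among the top [n / log n] that no step
   has moved. At time [n log n - n log log n - c n] their mean number is of order
   [exp c], and the second moment method shows that one such card, hence a fixed
   point among the top positions, exists with probability at least
   [1 - exp (2 - c) - o(1)]; under the uniform distribution this has probability
   [O(1 / log n)]. The bound [exp (- x) <= pi^2 / (6 x^2)] concludes. *)

(** * Averages over words of independent letters *)

Section Words.
Variables (R : realType) (I : finType).
Implicit Types (p : I -> R) (F G : seq I -> R).

(* The expectation of [F] along [t] independent draws from [p]. *)
Fixpoint word_sum p (t : nat) F : R :=
  if t is t'.+1 then \sum_i p i * word_sum p t' (fun s => F (i :: s))
  else F [::].

Lemma le_word_sum p t F G : (forall i, 0 <= p i) -> (forall s, F s <= G s) ->
  word_sum p t F <= word_sum p t G.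
Proof.
move=> p0; elim: t F G => [|t IH] F G FG /=; first exact: FG.
by apply: ler_sum => i _; apply: ler_wpM2l => //; apply: IH.
Qed.

Lemma word_sumZ p t a F :
  word_sum p t (fun s => a * F s) = a * word_sum p t F.
Proof.
elim: t F => [//|t IH] F /=.
by rewrite big_distrr; apply: eq_bigr => i _; rewrite IH mulrCA.
Qed.

Lemma word_sum_sum (J : Type) (r : seq J) p t (F : J -> seq I -> R) :
  word_sum p t (fun s => \sum_(j <- r) F j s) =
  \sum_(j <- r) word_sum p t (F j).
Proof.
elim: t F => [//|t IH] F /=.
rewrite exchange_big; apply: eq_bigr => i _.
by rewrite IH big_distrr.
Qed.

Lemma word_sumD p t F G :
  word_sum p t (fun s => F s + G s) = word_sum p t F + word_sum p t G.
Proof.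
elim: t F G => [//|t IH] F G /=.
by rewrite -big_split; apply: eq_bigr => i _; rewrite IH mulrDr.
Qed.

Lemma word_sum_all p t (a : pred I) :
  word_sum p t (fun s => (all a s)%:R) = (\sum_(i | a i) p i) ^+ t.
Proof.
elim: t => [//|t IH] /=; rewrite exprS big_distrl [RHS]big_mkcond.
apply: eq_bigr => i _; case: (a i) => /=; first by rewrite IH.
have -> : (fun s : seq I => (false : nat)%:R) = (fun s : seq I => 0 * 0) :> (_ -> R).
  by apply/funext => s; rewrite mul0r.
by rewrite word_sumZ mul0r mulr0.
Qed.

End Words.

(** * Random walks on a finite group; total variation and separation *)

Section Walks.
Variables (R : realType) (gT : finGroupType).
Implicit Types (P mu nu : gT -> R).

(** Passing from the law at time [t] to the sequence of steps lets events on the final element be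
    compared, word by word, with events on the single steps. *)
Lemma convpow_word_sum P t (phi : gT -> R) :
  \sum_g convpow P t g * phi g =
  word_sum P t (fun s => phi (\prod_(g <- s) g)%g).
Proof.
elim: t phi => [|t IH] phi.
  rewrite /= big_nil /dirac1 (bigD1 1%g) //= eqxx mul1r big1 ?addr0 // => g.
  by move=> /negbTE ->; rewrite mul0r.
rewrite /=; under eq_bigr => g _ do rewrite /convolution big_distrl.
rewrite exchange_big; apply: eq_bigr => h _ /=.
under [X in _ * word_sum _ _ X]funext => s do rewrite big_cons.
rewrite -(IH (fun g => phi (h * g)%g)) big_distrr.
rewrite (reindex_inj (mulgI h)) /=; apply: eq_bigr => g _.
by rewrite mulKg mulrA.
Qed.

(** Convolution is bilinear, so a mixture of kernels can be expanded; this conditions the walk on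
    the sequence of chosen indices. *)
Lemma convpow_mixture (I : finType) (p : I -> R) (M : I -> gT -> R) P t g :
  P = (fun h => \sum_i p i * M i h) ->
  convpow P t g =
  word_sum p t (fun s => foldr (fun i => convolution (M i)) (@dirac1 R gT) s g).
Proof.
move=> ->; elim: t g => [//|t IH] g; rewrite /= {1}/convolution.
under [LHS]eq_bigr => h _ do rewrite /= big_distrl.
rewrite exchange_big; apply: eq_bigr => i _ /=.
rewrite /convolution word_sum_sum big_distrr; apply: eq_bigr => h _ /=.
by rewrite word_sumZ IH /= mulrA.
Qed.

Lemma sum_convolution mu nu :
  \sum_g convolution mu nu g = (\sum_g mu g) * (\sum_g nu g).
Proof.
rewrite exchange_big big_distrl; apply: eq_bigr => h _ /=.
rewrite big_distrr (reindex_inj (mulgI h)) /=; apply: eq_bigr => g _.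
by rewrite mulKg.
Qed.

Lemma sum_dirac1 : \sum_g dirac1 R (g : gT) = 1.
Proof.
rewrite (bigD1 1%g) //= /dirac1 eqxx big1 ?addr0 // => g.
by move=> /negbTE ->.
Qed.

Lemma sum_convpow P t : \sum_g P g = 1 -> \sum_g convpow P t g = 1.
Proof.
move=> P1; elim: t => [|t IH]; first exact: sum_dirac1.
by rewrite /= sum_convolution P1 IH mul1r.
Qed.

Lemma convpow_ge0 P t g : (forall h, 0 <= P h) -> 0 <= convpow P t g.
Proof.
move=> P0; elim: t g => [|t IH] g; first exact: ler0n.
by apply: sumr_ge0 => h _; apply: mulr_ge0.
Qed.

Lemma unif_ge0 (g : gT) : 0 <= unif R g.
Proof. by rewrite /unif invr_ge0 ler0n. Qed.

Lemma card_group_neq0 : #|gT|%:R != 0 :> R.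
Proof. by rewrite pnatr_eq0 -lt0n; apply/card_gt0P; exists 1%g. Qed.

Lemma sum_unif : \sum_g unif R (g : gT) = 1.
Proof. by rewrite sumr_const -[LHS]mulr_natr mulVf ?card_group_neq0. Qed.

(** Since both masses are 1, the excess of [mu] on [a] equals the excess of [nu] on the complement;
    the two contributions cancel the factor 1/2. *)
Lemma tv_dist_ge mu nu (a : pred gT) :
  \sum_g mu g = 1 -> \sum_g nu g = 1 ->
  \sum_(g | a g) mu g - \sum_(g | a g) nu g <= tv_dist mu nu.
Proof.
move=> mu1 nu1; rewrite /tv_dist [X in _ * X](bigID a) /=.
have h1 : \sum_(g | a g) mu g - \sum_(g | a g) nu g <=
          \sum_(g | a g) `|mu g - nu g|.
  by rewrite -sumrB; apply: ler_sum => g _; apply: ler_norm.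
have h2 : \sum_(g | ~~ a g) nu g - \sum_(g | ~~ a g) mu g <=
          \sum_(g | ~~ a g) `|mu g - nu g|.
  by rewrite -sumrB; apply: ler_sum => g _; rewrite distrC; apply: ler_norm.
move: mu1 nu1; rewrite (bigID a) /= [X in _ -> X = _ -> _](bigID a) /= => mu1 nu1.
lra.
Qed.

Lemma tv_dist_ge0 mu nu : 0 <= tv_dist mu nu.
Proof. by rewrite mulr_ge0 ?invr_ge0 ?sumr_ge0. Qed.

Lemma sep_dist_le mu b : (forall g, 1 - b <= mu g * #|gT|%:R) ->
  sep_dist mu (@unif R gT) <= b.
Proof.
move=> h; have hb g : 1 - mu g / unif R g <= b.
  by rewrite /unif invrK lerBlDr -lerBlDl.
by apply: bigmax_le.
Qed.

Lemma sep_dist_le1 mu : (forall g, 0 <= mu g) -> sep_dist mu (@unif R gT) <= 1.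
Proof.
by move=> mu0; apply: sep_dist_le => g; rewrite subrr mulr_ge0 ?ler0n.
Qed.

Lemma sep_dist_ub mu nu g : 1 - mu g / nu g <= sep_dist mu nu.
Proof. by rewrite /sep_dist; apply: le_bigmax. Qed.

(** The difference [d = mu - unif] has total mass 0 and negative part at most [b * unif], and [|d|]
    is [d] plus twice its negative part. *)
Lemma tv_le_sep mu : \sum_g mu g = 1 ->
  tv_dist mu (@unif R gT) <= sep_dist mu (@unif R gT).
Proof.
move=> mu1; set b := sep_dist _ _.
have hb g : unif R g - mu g <= b * unif R g.
  have := sep_dist_ub mu (@unif R gT) g; rewrite -/b => /(ler_wpM2r (unif_ge0 g)).
  by rewrite mulrBl mul1r divfK // invr_eq0 card_group_neq0.
have b0 : 0 <= b.
  have : \sum_g (unif R g - mu g) <= \sum_g b * unif R (g : gT).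
    by apply: ler_sum => g _; apply: hb.
  by rewrite sumrB mu1 sum_unif subrr -big_distrr /= sum_unif mulr1.
have h g : `|mu g - unif R g| <= (mu g - unif R g) + 2 * (b * unif R g).
  have := hb g; have : 0 <= b * unif R g by rewrite mulr_ge0 ?unif_ge0.
  by case: (ger0P (mu g - unif R g)) => _; lra.
rewrite /tv_dist; have : \sum_g `|mu g - unif R g| <=
    \sum_(g : gT) ((mu g - unif R g) + 2 * (b * unif R g)) by apply: ler_sum.
rewrite big_split /= sumrB mu1 -!big_distrr /= sum_unif; lra.
Qed.

(* Second moment method: if [N] counts the [k] in [V] for which all steps lie in
   [H k], then [1_(N > 0) >= 2 a N - (a N) ^ 2] for every [a]. *)
Lemma convpow_union_ge (K : finType) (V : pred K) (H : K -> pred gT) P t a :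
  (forall g, 0 <= P g) ->
  (forall k, H k 1%g) -> (forall k g h, H k g -> H k h -> H k (g * h)%g) ->
  2 * a * (\sum_(k | V k) (\sum_(g | H k g) P g) ^+ t)
  - a ^+ 2 * (\sum_(k | V k) \sum_(l | V l)
                (\sum_(g | H k g && H l g) P g) ^+ t)
  <= \sum_(g | [exists k, V k && H k g]) convpow P t g.
Proof.
move=> P0 H1 HM.
pose phi g : R := [exists k, V k && H k g]%:R.
have -> : \sum_(g | [exists k, V k && H k g]) convpow P t g =
          \sum_g convpow P t g * phi g.
  rewrite big_mkcond; apply: eq_bigr => g _; rewrite /phi.
  by case: ifP; rewrite ?mulr1 ?mulr0.
rewrite convpow_word_sum.
under eq_bigr => k _ do rewrite -word_sum_all.
under [X in _ - _ * X]eq_bigr => k _ do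
  (under eq_bigr => l _ do rewrite -word_sum_all).
rewrite -[\sum_(k | V k) _]big_filter -word_sum_sum.
rewrite -[\sum_(k | V k) _]big_filter.
under [X in _ - _ * X]eq_bigr => k _ do rewrite -big_filter -word_sum_sum.
rewrite -word_sum_sum -mulNr -!word_sumZ -word_sumD.
apply: le_word_sum => // s; rewrite !big_filter.
under [X in _ + _ * X]eq_bigr => k _ do rewrite big_filter.
set N := \sum_(k | V k) _.
have -> : \sum_(k | V k) \sum_(l | V l)
    (all (fun g => H k g && H l g) s)%:R = N ^+ 2 :> R.
  rewrite expr2 {1}/N big_distrl; apply: eq_bigr => k _.
  rewrite big_distrr; apply: eq_bigr => l _ /=.
  by rewrite -natrM mulnb all_predI.
rewrite {}/phi; case: (boolP [exists k, _]) => [_|].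
  by rewrite /= -subr_ge0 (_ : _ - _ = (1 - a * N) ^+ 2) ?sqr_ge0 //; ring.
move/existsPn => nH; suff -> : N = 0 by rewrite expr0n /=; lra.
apply: big1 => k Vk; have := nH k; rewrite Vk /= => nHk.
rewrite (_ : all _ s = false) //; apply: contraNF nHk => /allP sH.
by rewrite big_seq; apply: (big_ind (H k)) => //; apply: HM.
Qed.

End Walks.

(** * Signed transpositions and their conjugates *)

Section SignedTranspositions.
Variable n : nat.
Implicit Types (g h s : 'B_n) (x y : signed n) (i j k l : 'I_n).

Lemma sgval_mul g h x : sgval (g * h)%g x = sgval h (sgval g x).
Proof. by rewrite sgvalM ?inE // permM. Qed.

Lemma sgval_1 x : sgval (1%g : 'B_n) x = x.
Proof. by rewrite perm1. Qed.

Lemma sgval_neg g x : sgval g (sneg x) = sneg (sgval g x).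
Proof. by have /hyperoctP := subgP g. Qed.

Lemma hyperoct_eq g h :
  (forall i, sgval g (false, i) = sgval h (false, i)) -> g = h.
Proof.
move=> gh; apply/val_inj/permP => -[[] i]; last exact: gh.
by have := congr1 (@sneg n) (gh i); rewrite -!sgval_neg.
Qed.

(** Indexing by the image [x] of [j] merges all generators into one family: [x = j] gives the
    identity, [x = -j] gives [xi j], and any other [x] one of the two kinds of transposition. *)
Definition strans j x : 'B_n :=
  if x.2 == j then (if x.1 then xi j else 1%g)
  else if x.1 then (xi x.2 * xi j * transp x.2 j)%g else transp x.2 j.

Lemma stransE j x y : sgval (strans j x) y =
  if y == (false, j) then x else if y == (true, j) then sneg x
  else if y == x then (false, j) else if y == sneg x then (true, j) else y.
Proof.
case: x y => [b i] [c k]; rewrite /strans /sneg /= !signed_eqE.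
have [->|ij] := eqVneq i j.
  have [->|kj] := eqVneq k j; case: b; case: c;
    by do ?rewrite ?sgval_1 ?permE /= ?signed_eqE ?eqxx ?(negbTE kj) /=.
have [->|ki] := eqVneq k i.
  by case: b; case: c; rewrite ?sgval_mul /=;
    do ?rewrite ?permM ?permE /= ?signed_eqE ?eqxx ?(negbTE ij) /=.
have [->|kj] := eqVneq k j; case: b; case: c; rewrite ?sgval_mul /=;
  by do ?rewrite ?permM ?permE /= ?signed_eqE ?eqxx ?(negbTE ij) ?(negbTE ki)
    ?(negbTE kj) 1?[j == i]eq_sym /=.
Qed.

Lemma strans_j j x : sgval (strans j x) (false, j) = x.
Proof. by rewrite stransE eqxx. Qed.

Lemma strans_x j x : sgval (strans j x) x = (false, j).
Proof.
rewrite stransE eqxx; case: (eqVneq x (false, j)) => [->//|xj].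
by case: (eqVneq x (true, j)) => [->|].
Qed.

Lemma strans_fix j x i : i != j -> i != x.2 ->
  sgval (strans j x) (false, i) = (false, i).
Proof.
case: x => b k /= ij ik; rewrite stransE /sneg /= !signed_eqE.
by rewrite (negbTE ij) (negbTE ik) !andbF.
Qed.

(** Conjugation by [s] relabels the exchanged points, and [s] fixes both [j] and [-j]. *)
Lemma strans_conj j x s : sgval s (false, j) = (false, j) ->
  (strans j x * s = s * strans j (sgval s x))%g.
Proof.
move=> sj; have sj' : sgval s (true, j) = (true, j).
  by have := sgval_neg s (false, j); rewrite sj.
apply: hyperoct_eq => i; rewrite !sgval_mul !stransE -sgval_neg.
(* Writing [j] as [s j] on the right turns each test into an equality of images under [s], which
   injectivity reduces to the test on the left. *)
rewrite -{3}sj -{3}sj' !(inj_eq perm_inj).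
by do 4! [case: ifP => _ //].
Qed.

(** Keeps the range of the sum over [x] stable under the relabelling in [ost_step_comm]. *)
Lemma strans_le k y j x : (k <= j)%N -> (y.2 <= j)%N ->
  ((sgval (strans k y) x).2 <= j)%N = (x.2 <= j)%N.
Proof.
move=> kj yj; rewrite stransE; case: eqP => [->|_]; first by rewrite kj yj.
case: eqP => [->|_]; first by rewrite kj /= yj.
case: eqP => [->|_]; first by rewrite kj yj.
by case: eqP => [->|_] //; rewrite kj /= yj.
Qed.

Lemma sum_signed_eq (R : realType) k :
  \sum_(x : signed n) (x.2 == k)%:R = 2 :> R.
Proof.
rewrite -(pair_bigA _ (fun (b : bool) i => (i == k)%:R)) /= big_bool.
have -> : \sum_i (i == k)%:R = 1 :> R.
  by rewrite (bigD1 k) //= eqxx big1 ?addr0 // => i /negbTE ->.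
by [].
Qed.

End SignedTranspositions.

(** * Reordering words of commuting letters *)

Lemma foldr_perm (T : eqType) (U : Type) (f : T -> U -> U) (u : U)
    (s1 s2 : seq T) :
  (forall x y v, f x (f y v) = f y (f x v)) -> perm_eq s1 s2 ->
  foldr f u s1 = foldr f u s2.
Proof.
move=> fC; elim: s1 s2 => [|x s1 IH] s2 s12.
  by move: s12; rewrite perm_sym => /perm_nilP ->.
have xs2 : x \in s2 by rewrite -(perm_mem s12) mem_head.
case/splitPr: xs2 s12 => a b.
rewrite perm_sym -(cat1s x b) perm_catCA /= perm_cons perm_sym => /IH ->.
by rewrite !foldr_cat /=; elim: a => //= y a <-.
Qed.

Lemma uniq_sub_perm (T : eqType) (s0 s : seq T) :
  uniq s0 -> {subset s0 <= s} -> exists r, perm_eq s (s0 ++ r).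
Proof.
elim: s0 s => [|x s0 IH] s /=; first by exists s.
case/andP=> xs0 us0 sub.
have xs : x \in s by rewrite sub ?mem_head.
have [|r sr] := IH (rem x s) us0.
  move=> y ys0; have : y \in s by rewrite sub // inE ys0 orbT.
  rewrite (perm_mem (perm_to_rem xs)) inE => /predU1P [yx|//].
  by rewrite -yx ys0 in xs0.
by exists r; rewrite (permPl (perm_to_rem xs)) perm_cons.
Qed.

Lemma ord_ltn_eqF (n : nat) (i j : 'I_n) : (i < j)%N -> (i == j) = false.
Proof. by move=> ij; rewrite -val_eqE /= ltn_eqF. Qed.

(** * Commuting steps, uniformity and the separation bound *)

Section OneSidedSteps.
Variables (R : realType) (n : nat).
Implicit Types (g h : 'B_n) (x y : signed n) (i j k l : 'I_n).

(* The step of the walk given that the right hand has chosen [j]. *)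
Definition ost_step j g : R :=
  (2 * j.+1%:R)^-1 * \sum_(x : signed n | (x.2 <= j)%N) (g == strans j x)%:R.

Lemma sum_delta (T : finType) (a : T) (f : T -> R) :
  \sum_b (b == a)%:R * f b = f a.
Proof.
rewrite (bigD1 a) //= eqxx mul1r big1 ?addr0 // => b /negbTE ->.
by rewrite mul0r.
Qed.

Lemma sum_ost_step j (f : 'B_n -> R) :
  \sum_g ost_step j g * f g =
  (2 * j.+1%:R)^-1 * \sum_(x : signed n | (x.2 <= j)%N) f (strans j x).
Proof.
under eq_bigr => g _ do rewrite /ost_step -mulrA big_distrl.
rewrite -big_distrr exchange_big /=; congr (_ * _).
by apply: eq_bigr => x _; rewrite sum_delta.
Qed.

Lemma sum_signed_le j : \sum_(x : signed n | (x.2 <= j)%N) 1 = 2 * j.+1%:R :> R.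
Proof.
rewrite big_mkcond
  -(pair_bigA _ (fun (b : bool) i => if (i <= j)%N then 1 else 0 : R)).
rewrite /= big_bool -big_mkcond /=.
have -> : \sum_(i < n | (i <= j)%N) 1 = j.+1%:R :> R.
  by rewrite -(big_ord_widen _ (fun=> 1) (ltn_ord j)) sumr_const card_ord.
by rewrite mulr_natl.
Qed.

Lemma ost_step_ge0 j g : 0 <= ost_step j g.
Proof. by rewrite mulr_ge0 ?invr_ge0 ?mulr_ge0 ?ler0n ?sumr_ge0. Qed.

Lemma ost_step_sum j : \sum_g ost_step j g = 1.
Proof.
have := sum_ost_step j (fun=> 1); rewrite sum_signed_le mulVf; last first.
  by rewrite mulf_neq0 ?pnatr_eq0.
by under eq_bigr => g _ do rewrite mulr1.
Qed.

(** With [j] counted from 1, the mass [1/(2nj)] is [1/n] for choosing [j] times [1/(2j)] for one of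
    the [2j] signed positions up to [j]. The mass at the identity collects the draws [x = j]. *)
Lemma ost0_mixture : @ost0 R n = (fun g => \sum_j n%:R^-1 * ost_step j g).
Proof.
apply/funext => g; rewrite /ost0 big_distrr big_distrl -!big_split.
apply: eq_bigr => j _ /=; rewrite /ost_step.
have -> : \sum_(x : signed n | (x.2 <= j)%N) (g == strans j x)%:R =
    \sum_(b : bool) \sum_(i < n)
      if (i <= j)%N then (g == strans j (b, i))%:R else 0 :> R.
  by rewrite pair_bigA big_mkcond; apply: eq_bigr => -[].
rewrite big_bool /=.
have split_j (f : 'I_n -> R) : \sum_(i < n) (if (i <= j)%N then f i else 0) =
    f j + \sum_(i < n | (i < j)%N) f i.
  rewrite -big_mkcond (bigD1 j) //=; congr (_ + _); apply: eq_bigl => i.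
  by rewrite ltn_neqAle andbC.
rewrite !split_j {1 3}/strans /= eqxx.
have -> : \sum_(i < n | (i < j)%N) (g == strans j (true, i))%:R =
    \sum_(i < n | (i < j)%N) (g == xi i * xi j * transp i j)%g%:R :> R.
  by apply: eq_bigr => i /ord_ltn_eqF ij; rewrite /strans /= ij.
have -> : \sum_(i < n | (i < j)%N) (g == strans j (false, i))%:R =
    \sum_(i < n | (i < j)%N) (g == transp i j)%:R :> R.
  by apply: eq_bigr => i /ord_ltn_eqF ij; rewrite /strans /= ij.
rewrite -big_distrr big_split /= !invfM; ring.
Qed.

Lemma ost0_ge0 g : 0 <= ost0 R g.
Proof.
rewrite ost0_mixture sumr_ge0 // => j _.
by rewrite mulr_ge0 ?invr_ge0 ?ler0n ?ost_step_ge0.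
Qed.

Lemma sum_ost0 (a : pred 'B_n) :
  \sum_(g | a g) ost0 R g = n%:R^-1 * \sum_j \sum_(g | a g) ost_step j g.
Proof.
under eq_bigr => g _ do rewrite ost0_mixture.
rewrite exchange_big big_distrr; apply: eq_bigr => j _ /=.
by rewrite -big_distrr.
Qed.

Lemma ost0_sum : (0 < n)%N -> \sum_(g : 'B_n) ost0 R g = 1.
Proof.
move=> n0; rewrite sum_ost0; under eq_bigr => j _ do rewrite ost_step_sum.
by rewrite sumr_const card_ord mulVf // pnatr_eq0 -lt0n.
Qed.

Lemma convolution_ost_step j (Q : 'B_n -> R) g :
  convolution (ost_step j) Q g =
  (2 * j.+1%:R)^-1 *
    \sum_(x : signed n | (x.2 <= j)%N) Q ((strans j x)^-1 * g)%g.
Proof. exact: (sum_ost_step j (fun h => Q (h^-1 * g)%g)). Qed.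

(** For [k < j], a transposition drawn with [k] fixes [j]. Moving it past one drawn with [j]
    therefore only permutes the signed positions up to [j], and the draw among these is uniform. *)
Lemma ost_step_comm j k (Q : 'B_n -> R) :
  convolution (ost_step j) (convolution (ost_step k) Q) =
  convolution (ost_step k) (convolution (ost_step j) Q).
Proof.
wlog kj : j k / (k < j)%N => [wlg|].
  have [/wlg//|/wlg->//|/val_inj->//] := ltngtP k j.
apply/funext => g; rewrite !convolution_ost_step.
under eq_bigr => x _ do rewrite convolution_ost_step.
under [in RHS]eq_bigr => x _ do rewrite convolution_ost_step.
rewrite -!big_distrr /= mulrCA; do 2! congr (_ * _).
rewrite exchange_big; apply: eq_bigr => y yk /=.
have yj : (y.2 <= j)%N by rewrite (leq_trans yk) // ltnW.
rewrite [RHS](reindex_inj (@perm_inj _ (sgval (strans k y)))) /=.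
apply: eq_big => [x|x _]; first by rewrite strans_le // ltnW.
rewrite !mulgA -!invMg -strans_conj // strans_fix //.
  by rewrite eq_sym ord_ltn_eqF.
by rewrite eq_sym ord_ltn_eqF // (leq_ltn_trans yk).
Qed.

Definition conv_word (Q : 'B_n -> R) (s : seq 'I_n) : 'B_n -> R :=
  foldr (fun j => convolution (ost_step j)) Q s.

Lemma sum_conv_word Q s : \sum_g conv_word Q s g = \sum_g Q g.
Proof.
elim: s => [//|j s IH]; rewrite /= sum_convolution ost_step_sum mul1r.
exact: IH.
Qed.

Lemma conv_word_ge0 Q s g : (forall h, 0 <= Q h) -> 0 <= conv_word Q s g.
Proof.
move=> Q0; elim: s g => [//|j s IH] g.
by apply: sumr_ge0 => h _; rewrite mulr_ge0 ?ost_step_ge0 ?IH.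
Qed.

Definition fixes_from (m : nat) g : bool :=
  [forall i : 'I_n, (m <= i)%N ==> (sgval g (false, i) == (false, i))].

Lemma fixes_fromP m g : reflect
  (forall i, (m <= i)%N -> sgval g (false, i) = (false, i)) (fixes_from m g).
Proof.
apply: (iffP forallP) => [h i mi|h i]; first exact/eqP/(implyP (h i)).
by apply/implyP => mi; rewrite h.
Qed.

(* The signed transpositions of [j] with the positions up to [j] are coset
   representatives of the stabilizer of [j, ..., n - 1] in that of
   [j + 1, ..., n - 1]. *)
Lemma fixes_from_coset j h x : (x.2 <= j)%N ->
  fixes_from j ((strans j x)^-1 * h)%g =
  fixes_from j.+1 h && (sgval h x == (false, j)).
Proof.
move=> xj.
have fix_st i : (j < i)%N -> sgval (strans j x) (false, i) = (false, i).
  move=> ji; rewrite strans_fix // eq_sym ord_ltn_eqF //.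
  exact: leq_ltn_trans ji.
apply/fixes_fromP/andP => [hf|[/fixes_fromP hf /eqP hx] i].
  have hE y : sgval h y = sgval ((strans j x)^-1 * h)%g (sgval (strans j x) y).
    by rewrite -sgval_mul mulKVg.
  split; last by rewrite hE strans_x hf.
  by apply/fixes_fromP => i ji; rewrite hE fix_st // hf // ltnW.
rewrite sgval_mul leq_eqVlt => /predU1P [/val_inj <-|ji].
  by rewrite -{1}(strans_x j x) -(sgval_mul (strans j x)) mulgV sgval_1.
by rewrite -{1}(fix_st i ji) -(sgval_mul (strans j x)) mulgV sgval_1 hf.
Qed.

(** The word [m - 1, ..., 0] averages over the stabilizer of [m, ..., n - 1]: each new letter runs
    over coset representatives. The constant may stay existential, since total mass determines it in
    [conv_word_unif]. *)
Lemma conv_word_stabilizer m : (m <= n)%N ->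
  exists s : seq 'I_n, exists c : R,
  [/\ uniq s, forall i, (i \in s) = (i < m)%N
    & forall Q g, conv_word Q s g =
        c * \sum_(h | fixes_from m h) Q (h^-1 * g)%g].
Proof.
elim: m => [_|m IH mn].
  exists [::], 1; split=> // Q g; rewrite mul1r (big_pred1 1%g) ?invg1 ?mul1g //.
  move=> h; apply/fixes_fromP/eqP => [hf|-> i _]; last exact: sgval_1.
  by apply: hyperoct_eq => i; rewrite hf // sgval_1.
have [s [c [us sm Qs]]] := IH (ltnW mn); pose j := Ordinal mn.
exists (j :: s), ((2 * j.+1%:R)^-1 * c); split=> [|i|Q g].
- by rewrite /= us sm ltnn.
- by rewrite inE sm -val_eqE /= -leq_eqVlt.
rewrite [LHS](convolution_ost_step j (conv_word Q s)).
under eq_bigr => x _ do rewrite Qs.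
rewrite -big_distrr -mulrA /=; do 2! congr (_ * _).
under eq_bigr => x xj.
  rewrite (reindex_inj (mulgI (strans j x)^-1)%g) /=.
  rewrite (eq_bigl _ _ (fun h => @fixes_from_coset j h x xj)).
  under eq_bigr => h _ do rewrite invMg invgK -mulgA mulKVg.
  over.
(* Each [h] in the larger stabilizer lies in exactly one coset, the one given by [x = h^-1 j]. *)
rewrite (exchange_big_dep (fixes_from m.+1)) /=; last by move=> x h _ /andP[].
apply: eq_bigr => h hf; rewrite (big_pred1 (sgval h^-1 (false, j))) // => x.
have hV y z : (sgval h y == z) = (y == sgval h^-1%g z).
  apply/eqP/eqP => [<-|->]; by rewrite -sgval_mul ?mulgV ?mulVg sgval_1.
(* This [x] has index at most [j]: [h] fixes [l] and [-l] for every [l > j], so it sends neither to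
   [j]. *)
rewrite hf hV /=; apply: andb_idl => /eqP ->; rewrite leqNgt; apply/negP => jl.
move/fixes_fromP/(_ _ jl): hf.
case E : (sgval h^-1%g (false, j)) jl => [b l] /= jl.
have : sgval h (b, l) = (false, j) by rewrite -E -sgval_mul mulVg sgval_1.
case: b {E} => hl; last by rewrite hl => -[jlE]; move: jl; rewrite -jlE ltnn.
rewrite -[(false, l)]/(sneg (true, l)) sgval_neg hl.
by case.
Qed.

(* The steps commute, so a word in which every [j] occurs can be reordered to
   start with [n - 1, ..., 1, 0], which is a Fisher-Yates shuffle. *)
Lemma conv_word_unif Q s : \sum_g Q g = 1 -> (forall j, j \in s) ->
  conv_word Q s = @unif R _.
Proof.
move=> Q1 js; have [s0 [c [us0 _ Qs0]]] := conv_word_stabilizer (leqnn n).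
have [//|r sr] := @uniq_sub_perm _ s0 s us0 _.
have E g : conv_word Q s g = c.
  rewrite /conv_word (foldr_perm _ _ sr); last exact: ost_step_comm.
  rewrite foldr_cat -/(conv_word Q r) -/(conv_word _ s0) Qs0.
  rewrite (eq_bigl xpredT); last first.
    by move=> h; apply/fixes_fromP => i; rewrite leqNgt ltn_ord.
  rewrite (reindex_inj invg_inj) (reindex_inj (mulIg g^-1)%g) /=.
  under eq_bigr => h _ do rewrite invgK mulgVK.
  by rewrite sum_conv_word Q1 mulr1.
have := sum_conv_word Q s; rewrite Q1 (eq_bigr (fun=> c)) // sumr_const.
rewrite -[LHS]mulr_natr => c1; apply/funext => g; rewrite E /unif.
by rewrite -[RHS]mul1r -[X in X * _]c1 mulfK // card_group_neq0.
Qed.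

(** Given the word of chosen indices, the conditional law is at least [1 - #missing] times the
    uniform one: it is uniform if nothing is missing, and otherwise the bound is not positive.
    Averaging over words gives the union bound. *)
Lemma sep_dist_ost0 t : (0 < n)%N ->
  sep_dist (convpow (@ost0 R n) t) (@unif R _) <= n%:R * (1 - n%:R^-1) ^+ t.
Proof.
move=> n0; have nN0 : n%:R != 0 :> R by rewrite pnatr_eq0 -lt0n.
apply: sep_dist_le => g; rewrite -ler_pdivrMr; last first.
  by rewrite lt0r card_group_neq0 ler0n.
rewrite (convpow_mixture t g ost0_mixture).
have -> : (1 - n%:R * (1 - n%:R^-1) ^+ t) / #|'B_n|%:R =
   word_sum (fun _ : 'I_n => n%:R^-1) t (fun s =>
     #|'B_n|%:R^-1 * ((all xpredT s)%:R +
       - 1 * \sum_j (all (predC1 j) s)%:R)) :> R.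
  rewrite word_sumZ word_sumD word_sumZ word_sum_sum word_sum_all mulrC.
  congr (_ * (_ + _)).
    by rewrite sumr_const card_ord -[_ *+ n]mulr_natr mulVf ?expr1n.
  under eq_bigr => j _.
    rewrite word_sum_all.
    have -> : \sum_(i < n | predC1 j i) n%:R^-1 = 1 - n%:R^-1 :> R.
      have : \sum_(i < n) n%:R^-1 = 1 :> R.
        by rewrite sumr_const card_ord -[LHS]mulr_natr mulVf.
      rewrite (bigD1 j) //= => sum1; apply: (addrI n%:R^-1).
      by rewrite addrCA subrr addr0; exact: sum1.
    over.
  by rewrite sumr_const card_ord mulN1r mulr_natl.
apply: le_word_sum => [_|s]; first by rewrite invr_ge0 ler0n.
rewrite all_predT mulN1r.
have [/forallP js|/forallPn[j js]] := boolP [forall j, j \in s].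
  rewrite -/(conv_word _ s) conv_word_unif ?sum_dirac1 // /unif.
  by rewrite ler_piMr ?invr_ge0 ?ler0n // gerBl sumr_ge0.
apply: (@le_trans _ _ 0); last by rewrite conv_word_ge0 // => h; rewrite ler0n.
rewrite mulr_ge0_le0 ?invr_ge0 ?ler0n // subr_le0 (bigD1 j) //=.
rewrite (_ : all _ s) ?lerDl ?sumr_ge0 //.
by apply/allP => i iS /=; apply: contraNneq js => <-.
Qed.

End OneSidedSteps.

(** * Unmoved cards and the total variation lower bound *)

Section FixedPoints.
Variables (R : realType) (n : nat).
Implicit Types (g h : 'B_n) (i j k l : 'I_n) (s t : nat).

Definition fixes k g : bool := sgval g (false, k) == (false, k).

Lemma fixes1 k : fixes k 1%g.
Proof. by rewrite /fixes sgval_1. Qed.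

Lemma fixesM k g h : fixes k g -> fixes k h -> fixes k (g * h)%g.
Proof. by rewrite /fixes sgval_mul => /eqP ->. Qed.

(** Right multiplication by [strans k x] carries the stabilizer of [k] to the elements sending [k]
    to [x], so the [2n] possible images are equally likely. *)
Lemma unif_fixes k : \sum_(g | fixes k g) unif R g = (2 * n%:R)^-1.
Proof.
have n0 : 2 * n%:R != 0 :> R.
  by rewrite mulf_neq0 ?pnatr_eq0 // -lt0n (leq_ltn_trans (leq0n k)).
have : \sum_(x : signed n) \sum_(g : 'B_n | sgval g (false, k) == x) unif R g = 1.
  rewrite -(@sum_unif R 'B_n).
  by rewrite [RHS](partition_big (fun g : 'B_n => sgval g (false, k)) xpredT).
rewrite (eq_bigr (fun=> \sum_(g | fixes k g) unif R g)) => [|x _].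
  rewrite sumr_const card_prod card_bool card_ord -[LHS]mulr_natl natrM => h.
  by apply: (mulfI n0); rewrite h mulfV.
rewrite (reindex_inj (mulIg (strans k x))) /=; apply: eq_bigl => g.
by rewrite sgval_mul -{2}(strans_j k x) (inj_eq perm_inj).
Qed.

(** For [j] other than [k], card [k] moves only if the signed position drawn is [k] or [-k]; this
    requires [k < j] and has 2 chances out of [2 (j + 1)]. *)
Lemma ost_step_moves j k : j != k ->
  \sum_(g | ~~ fixes k g) ost_step R j g <= (k < j)%:R / j.+1%:R.
Proof.
move=> jk.
have -> : \sum_(g | ~~ fixes k g) ost_step R j g =
    \sum_g ost_step R j g * (~~ fixes k g)%:R.
  by rewrite big_mkcond; apply: eq_bigr => g _; case: ifP;
    rewrite ?mulr1 ?mulr0.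
rewrite sum_ost_step.
have mv x : (~~ fixes k (strans j x))%:R <= (x.2 == k)%:R :> R.
  rewrite ler_nat; case: eqVneq => [_|xk]; first exact: leq_b1.
  by rewrite /fixes strans_fix ?eqxx // eq_sym.
have [kj|jk'] := ltnP k j.
  apply: (@le_trans _ _ ((2 * j.+1%:R)^-1 * \sum_(x : signed n) (x.2 == k)%:R)).
    rewrite ler_wpM2l ?invr_ge0 ?mulr_ge0 ?ler0n // big_mkcond.
    by apply: ler_sum => x _; case: ifP.
  by rewrite sum_signed_eq invfM mulrAC mulVf ?mul1r ?pnatr_eq0.
rewrite big1 ?mulr0 ?mul0r // => x xj; apply/eqP.
rewrite eq_le ler0n andbT (le_trans (mv x)) // ord_ltn_eqF //.
by rewrite (leq_ltn_trans xj) // ltn_neqAle jk' andbT.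
Qed.

Lemma ost_step_moves_le s j k : (0 < s)%N -> (s <= k)%N ->
  \sum_(g | ~~ fixes k g) ost_step R j g <= (j == k)%:R + (s <= j)%:R / s%:R.
Proof.
move=> s0 sk; case: eqVneq => [_|jk].
  apply: (@le_trans _ _ 1); last by rewrite lerDl divr_ge0 ?ler0n.
  rewrite -(ost_step_sum R j) [leRHS](bigID (fixes k)) /= lerDr.
  by apply: sumr_ge0 => g _; apply: ost_step_ge0.
rewrite (le_trans (ost_step_moves jk)) // add0r.
case: ltnP => [kj|_]; last by rewrite mul0r divr_ge0 ?ler0n.
have sj : (s <= j)%N by rewrite ltnW // (leq_ltn_trans sk).
by rewrite sj ler_wpM2l // lef_pV2 ?posrE ?ltr0n // ler_nat ltnW.
Qed.

(** Both cards move only if one of them is [j] and the other is, up to sign, the position drawn. *)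
Lemma ost_step_moves2_le s j k l : (0 < s)%N -> (s <= k)%N -> (s <= l)%N ->
  k != l ->
  \sum_(g | ~~ fixes k g && ~~ fixes l g) ost_step R j g <=
  ((j == k)%:R + (j == l)%:R) / s%:R.
Proof.
move=> s0 sk sl kl.
have sub (a b : pred 'B_n) : \sum_(g | a g && b g) ost_step R j g <=
    \sum_(g | b g) ost_step R j g.
  rewrite [leRHS]big_mkcond [leLHS]big_mkcond; apply: ler_sum => g _.
  by case: (a g); case: (b g); rewrite //= ost_step_ge0.
have bnd i : j != i -> (s <= j)%N ->
    \sum_(g | ~~ fixes i g) ost_step R j g <= s%:R^-1.
  move=> ji sj; rewrite (le_trans (ost_step_moves ji)) //.
  rewrite (@le_trans _ _ j.+1%:R^-1) ?ler_piMl ?invr_ge0 ?ler0n ?lern1 ?leq_b1 //.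
  by rewrite lef_pV2 ?posrE ?ltr0n // ler_nat ltnW.
case: (eqVneq j k) => [jk|jk].
  rewrite jk (negbTE kl) addr0 mul1r -jk (le_trans (sub _ _)) // bnd //.
    by rewrite jk.
  by rewrite jk.
case: (eqVneq j l) => [jl|jl].
  rewrite add0r mul1r; under eq_bigl => g do rewrite andbC.
  by rewrite (le_trans (sub _ _)) // bnd // jl.
rewrite addr0 mul0r.
have -> : \sum_(g | ~~ fixes k g && ~~ fixes l g) ost_step R j g =
    \sum_g ost_step R j g * (~~ fixes k g && ~~ fixes l g)%:R.
  by rewrite big_mkcond; apply: eq_bigr => g _; case: ifP;
    rewrite ?mulr1 ?mulr0.
rewrite sum_ost_step big1 ?mulr0 // => x _.
case: (eqVneq k x.2) => [kx|kx]; last first.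
  by rewrite {1}/fixes strans_fix ?eqxx // eq_sym.
rewrite [fixes l _]/fixes strans_fix ?eqxx ?andbF // 1?eq_sym //.
by rewrite -kx.
Qed.

Lemma sum_ge_ord s (x : R) : (s <= n)%N ->
  \sum_(k < n | (s <= k)%N) x = (n%:R - s%:R) * x.
Proof.
move=> sn; rewrite -(big_geq_mkord s n xpredT (fun=> x)) sumr_const_nat.
by rewrite -[LHS]mulr_natl natrB.
Qed.

(** Averaging the previous bounds over [j] gives [(1 + (n - s) / s) / n], which is exactly
    [1 / s]. *)
Lemma ost0_moves_le s k : (0 < s)%N -> (s <= k)%N ->
  \sum_(g | ~~ fixes k g) ost0 R g <= s%:R^-1.
Proof.
move=> s0 sk; have n0 : (0 < n)%N by rewrite (leq_ltn_trans (leq0n k)).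
have sn : (s <= n)%N by rewrite ltnW // (leq_ltn_trans sk).
have nN0 : n%:R != 0 :> R by rewrite pnatr_eq0 -lt0n.
have sN0 : s%:R != 0 :> R by rewrite pnatr_eq0 -lt0n.
rewrite sum_ost0 -ler_pdivlMl ?invr_gt0 ?ltr0n // invrK.
apply: (@le_trans _ _ (\sum_j ((j == k)%:R + (s <= j)%:R / s%:R))).
  by apply: ler_sum => j _; apply: ost_step_moves_le.
rewrite big_split -big_distrl /=.
have -> : \sum_j (j == k)%:R = 1 :> R.
  by rewrite (bigD1 k) //= eqxx big1 ?addr0 // => i /negbTE ->.
have -> : \sum_(j < n) (s <= j)%:R = n%:R - s%:R :> R.
  rewrite -[RHS]mulr1 -sum_ge_ord // [RHS]big_mkcond.
  by apply: eq_bigr => j _; case: (s <= j)%N.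
by rewrite mulrBl divff // addrC subrK.
Qed.

Lemma ost0_moves2_le s k l : (0 < s)%N -> (s <= k)%N -> (s <= l)%N -> k != l ->
  \sum_(g | ~~ fixes k g && ~~ fixes l g) ost0 R g <= 2 / (n%:R * s%:R).
Proof.
move=> s0 sk sl kl; have n0 : (0 < n)%N by rewrite (leq_ltn_trans (leq0n k)).
rewrite sum_ost0 -ler_pdivlMl ?invr_gt0 ?ltr0n // invrK.
apply: (@le_trans _ _ (\sum_j ((j == k)%:R + (j == l)%:R) / s%:R)).
  by apply: ler_sum => j _; apply: ost_step_moves2_le.
rewrite -big_distrl big_split /=.
have E i : \sum_j (j == i)%:R = 1 :> R.
  by rewrite (bigD1 i) //= eqxx big1 ?addr0 // => j /negbTE ->.
rewrite !E (_ : n%:R * (2 / _) = (1 + 1) / s%:R) //.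
by field; rewrite !pnatr_eq0 -!lt0n n0 s0.
Qed.

Lemma sum_fixes2 k l : (0 < n)%N ->
  \sum_(g | fixes k g && fixes l g) ost0 R g =
  1 - \sum_(g | ~~ fixes k g) ost0 R g - \sum_(g | ~~ fixes l g) ost0 R g
  + \sum_(g | ~~ fixes k g && ~~ fixes l g) ost0 R g.
Proof.
move=> n0; have := ost0_sum R n0; rewrite (bigID (fixes k)) /= => <-.
rewrite [X in X + _ - _ - _](bigID (fixes l)) /= addrK.
rewrite [X in _ - X + _](bigID (fixes k)) /=.
under [X in _ - (X + _) + _]eq_bigl => g do rewrite andbC.
under [X in _ - (_ + X) + _]eq_bigl => g do rewrite andbC.
ring.
Qed.

Lemma sum_fixes k : (0 < n)%N ->
  \sum_(g | fixes k g) ost0 R g = 1 - \sum_(g | ~~ fixes k g) ost0 R g.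
Proof.
by move=> n0; rewrite -(ost0_sum R n0) [X in X - _](bigID (fixes k)) /= addrK.
Qed.

(** The test event is that some card among [s, ..., n - 1] is fixed. The second moment method bounds
    it below for the walk, with [rho] controlling the correlations, and a union bound bounds it
    above for [unif]. *)
Lemma tv_dist_ost0 s t : (1 < s < n)%N ->
  2 - (1 + 8 / (n%:R * s%:R)) ^+ t
    - ((n%:R - s%:R) * (1 - s%:R^-1) ^+ t)^-1 - (n%:R - s%:R) / (2 * n%:R)
  <= tv_dist (convpow (@ost0 R n) t) (@unif R _).
Proof.
case/andP=> s1 sn; have n0 : (0 < n)%N by rewrite (leq_ltn_trans (leq0n s)).
have s0 : (0 < s)%N by exact: ltnW.
set rho := _ ^+ t; set m := n%:R - s%:R.
pose V := [pred k : 'I_n | (s <= k)%N].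
pose p k : R := \sum_(g | fixes k g) ost0 R g.
have Vsum (x : R) : \sum_(k | V k) x = m * x.
  by rewrite sum_ge_ord // ltnW.
have m0 : 0 < m by rewrite subr_gt0 ltr_nat.
have is2 : s%:R^-1 <= 2^-1 :> R.
  by rewrite lef_pV2 ?posrE ?ltr0n // ler_nat.
have is0 : 0 < s%:R^-1 :> R by rewrite invr_gt0 ltr0n.
have pge k : V k -> 1 - s%:R^-1 <= p k.
  by move=> Vk; rewrite /p sum_fixes // lerD2l lerN2 ost0_moves_le.
have r0 : 0 <= 8 / (n%:R * s%:R) :> R by rewrite divr_ge0 ?mulr_ge0 ?ler0n.
have rho0 : 0 <= rho by rewrite exprn_ge0 // addr_ge0.
have pp0 k : 0 <= p k by apply: sumr_ge0 => g _; apply: ost0_ge0.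
have p2 k l : V k -> V l -> k != l ->
    (\sum_(g | fixes k g && fixes l g) ost0 R g) ^+ t <=
    rho * (p k ^+ t * p l ^+ t).
  move=> Vk Vl kl; rewrite -!exprMn lerXn2r ?nnegrE //.
  - by apply: sumr_ge0 => g _; apply: ost0_ge0.
  - by rewrite !mulr_ge0 ?addr_ge0.
  have := pge k Vk; have := pge l Vl; rewrite sum_fixes2 //.
  have := ost0_moves2_le s0 Vk Vl kl; rewrite /p !sum_fixes //.
  set b := \sum_(g | _ && _) _; set x := \sum_(g | _) _; set y := \sum_(g | _) _.
  (* Both [p k] and [p l] are at least 1/2, so the additive error [2 / (n s)] is at most [8 / (n s)]
     times their product. *)
  have -> : 2 / (n%:R * s%:R) = (8 / (n%:R * s%:R)) / 4 :> R.
    by field; rewrite !pnatr_eq0; lia.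
  move: r0; set r := 8 / _ => r0 br yq xq.
  have : 0 <= (1 - x - 1 / 2) * (1 / 2) + (1 - y - 1/2) * (1 - x).
    by rewrite addr_ge0 // mulr_ge0 //; lra.
  move=> H; have xy : 0 <= (1 - x) * (1 - y) - 1 / 4 by lra.
  have x0 : 0 <= x by apply: sumr_ge0 => g _; apply: ost0_ge0.
  have y0 : 0 <= y by apply: sumr_ge0 => g _; apply: ost0_ge0.
  have := mulr_ge0 r0 xy; have := mulr_ge0 x0 y0; lra.
pose M := \sum_(k | V k) p k ^+ t.
have M_ge : m * (1 - s%:R^-1) ^+ t <= M.
  rewrite -Vsum; apply: ler_sum => k Vk; rewrite lerXn2r ?nnegrE ?pge //.
  lra.
have mp0 : 0 < m * (1 - s%:R^-1) ^+ t.
  by rewrite mulr_gt0 // exprn_gt0 //; lra.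
have M0 : 0 < M by apply: lt_le_trans M_ge.
(* The diagonal terms add up to [M], the others to at most [rho * M ^+ 2]. *)
have E2 : \sum_(k | V k) \sum_(l | V l)
    (\sum_(g | fixes k g && fixes l g) ost0 R g) ^+ t <= M + rho * M ^+ 2.
  have -> : M + rho * M ^+ 2 =
      \sum_(k | V k) (p k ^+ t + rho * (p k ^+ t * M)).
    by rewrite big_split -big_distrr -big_distrl.
  apply: ler_sum => k Vk; rewrite (bigD1 k) //= /M big_distrr big_distrr /=.
  apply: lerD; first by under eq_bigl do rewrite andbb.
  rewrite [leRHS](bigD1 k) //=.
  apply: (@le_trans _ _ (\sum_(l | V l && (l != k)) rho * (p k ^+ t * p l ^+ t))).
    by apply: ler_sum => l /andP[Vl lk]; rewrite p2 // eq_sym.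
  by rewrite lerDr !mulr_ge0 ?exprn_ge0.
(* With [a] the inverse of the mean [M], the bound becomes [2 - rho - 1 / M]. *)
have low := @convpow_union_ge R _ _ V fixes (@ost0 R n) t M^-1
  (@ost0_ge0 R n) fixes1 fixesM.
have up : \sum_(g | [exists k, V k && fixes k g]) unif R g <= m / (2 * n%:R).
  rewrite -Vsum.
  under [leRHS]eq_bigr => k _ do rewrite -(unif_fixes k) big_mkcond.
  rewrite exchange_big big_mkcond; apply: ler_sum => g _ /=.
  have f0 k : 0 <= (if fixes k g then unif R g else 0).
    by case: ifP; rewrite ?unif_ge0.
  case: existsP => [[k /andP[Vk kg]]|_]; last exact: sumr_ge0.
  by rewrite (bigD1 k) //= kg lerDl sumr_ge0.
have tv := @tv_dist_ge R _ (convpow (@ost0 R n) t) (@unif R _)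
  (fun g => [exists k, V k && fixes k g])
  (sum_convpow t (ost0_sum R n0)) (sum_unif R _).
apply: le_trans tv; apply: (lerB _ up); apply: le_trans low.
apply: (@le_trans _ _ (2 * M^-1 * M - M^-1 ^+ 2 * (M + rho * M ^+ 2))).
  have -> : 2 * M^-1 * M - M^-1 ^+ 2 * (M + rho * M ^+ 2) = 2 - rho - M^-1.
    by field; rewrite gt_eqF.
  by rewrite lerD2l lerN2 lef_pV2 ?posrE.
by rewrite lerD2l lerN2 ler_wpM2l // sqr_ge0.
Qed.

End FixedPoints.

(** * Asymptotics in [n] and the cutoff *)

Section Asymptotics.
Variable R : realType.
Implicit Types (u : nat -> R) (a b c e l x y T : R) (n t : nat).

Lemma limn_esup_le u l :
  (forall e, 0 < e -> \forall n \near \oo, u n <= l + e) ->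
  (limn_esup (fun n => (u n)%:E) <= l%:E)%E.
Proof.
move=> ul; apply/lee_addgt0Pr => e e0; rewrite -EFinD.
apply: (@le_trans _ _ (ereal_sup
    [set (u n)%:E | n in [set n | u n <= l + e]])).
  by apply: ereal_inf_lbound; exists [set n | u n <= l + e] => //; apply: ul.
by apply: ge_ereal_sup => _ [n /= une <-]; rewrite lee_fin.
Qed.

Lemma limn_einf_ge u l :
  (forall e, 0 < e -> \forall n \near \oo, l - e <= u n) ->
  (l%:E <= limn_einf (fun n => (u n)%:E))%E.
Proof.
move=> ul; rewrite /limn_einf leeNr -EFinN.
apply: (@limn_esup_le (fun n => - u n)) => e e0.
by apply: filterS (ul e e0) => n; lra.
Qed.

Lemma sqr_le_expR x : 0 <= x -> x ^+ 2 / 2 <= expR x.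
Proof. by move=> x0; apply: le_trans (expR_ge1Dxn 1 x0); rewrite lerDr. Qed.

(** From [x = exp (ln x) >= (ln x)^2 / 2] and [ln x >= 2 / e]. *)
Lemma ln_le_eps e x : 0 < e -> 2 / e <= ln x -> ln x <= e * x.
Proof.
move=> e0 ex; have l0 : 0 < ln x by apply: lt_le_trans ex; rewrite divr_gt0.
(* The logarithm is 0 at nonpositive arguments, so [ln x > 0] forces [x > 0]. *)
have x0 : 0 < x by rewrite ltNge; apply: contraTN l0 => /ln0 ->; rewrite ltxx.
have := sqr_le_expR (ltW l0); rewrite lnK ?posrE // => xl.
have : 2 <= e * ln x by rewrite mulrC -ler_pdivrMr.
move=> /(ler_wpM2r (ltW l0)) h; have := ler_wpM2l (ltW e0) xl; nra.
Qed.

Lemma near_ln_ge a : \forall n \near \oo, a <= ln (n%:R : R).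
Proof.
apply: filterS (nbhs_infty_ger (expR a)) => n an.
by rewrite -ler_expR lnK // posrE (lt_le_trans _ an) ?expR_gt0.
Qed.

Lemma near_lnln_ge a : \forall n \near \oo, a <= ln (ln (n%:R : R)).
Proof.
apply: filterS (near_ln_ge (expR a)) => n an.
by rewrite -ler_expR lnK // posrE (lt_le_trans _ an) ?expR_gt0.
Qed.

Lemma near_lnln_le e : 0 < e ->
  \forall n \near \oo, ln (ln (n%:R : R)) <= e * ln n%:R.
Proof.
by move=> e0; apply: filterS (near_lnln_ge (2 / e)) => n; apply: ln_le_eps.
Qed.

Lemma near_ln_le e : 0 < e -> \forall n \near \oo, ln (n%:R : R) <= e * n%:R.
Proof. by move=> e0; apply: filterS (near_ln_ge (2 / e)) => n; apply: ln_le_eps. Qed.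

(** Uses [1 - 1/n <= exp (- 1/n)]. Truncating [T] loses less than one step, whence the extra [1/n]
    in the exponent. *)
Lemma sep_dist_walk_le n T c : (0 < n)%N -> 0 <= c ->
  n%:R * ln n%:R + c * n%:R <= T ->
  sep_dist (walk (@ost0 R n) T) (@unif R _) <= expR (- c + n%:R^-1).
Proof.
move=> n0 c0 nT; apply: (le_trans (sep_dist_ost0 _ _ n0)).
have nR : 0 < n%:R :> R by rewrite ltr0n.
have ln0 : 0 <= ln n%:R :> R by rewrite ln_ge0 // ler1n.
have T0 : 0 <= T by apply: le_trans nT; rewrite addr_ge0 ?mulr_ge0 ?ler0n.
have /andP[_] := truncn_itv T0; set t := Num.truncn T => Tt.
have {1}-> : n%:R = expR (ln n%:R) :> R by rewrite lnK.
have : (1 - n%:R^-1) ^+ t <= expR (- n%:R^-1) ^+ t :> R.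
  rewrite lerXn2r ?nnegrE ?expR_ge0 ?expR_ge1Dx //.
  by rewrite subr_ge0 invf_le1 // ler1n.
move=> /(ler_wpM2l (expR_ge0 (ln n%:R))) /le_trans; apply.
rewrite -expRM_natl -expRD ler_expR -(ler_pM2l nR).
have -> : n%:R * (ln n%:R + t%:R * - n%:R^-1) = n%:R * ln n%:R - t%:R :> R.
  by field; rewrite gt_eqF.
rewrite mulrDr mulfV ?gt_eqF //; move: Tt; rewrite -natr1; lra.
Qed.

Lemma tv_dist_ost0_log n t c : 0 <= c ->
  8 <= ln n%:R :> R -> ln n%:R <= 8^-1 * n%:R :> R ->
  t%:R <= n%:R * (ln n%:R - ln (ln n%:R) - c) ->
  1 - expR (2 - c) - (expR (16 * (ln n%:R / n%:R)) - 1) - (ln n%:R)^-1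
  <= tv_dist (convpow (@ost0 R n) t) (@unif R _).
Proof.
move=> c0; set L := ln n%:R => L8 Ln tn.
have N64 : 64 <= n%:R :> R by lra.
have n0 : 0 < n%:R :> R by lra.
have L0 : 0 < L by lra.
have lnL0 : 0 <= ln L by rewrite ln_ge0 //; lra.
(* Rounding up makes [1 / m <= L / n]; the tested cards are the top [m], so [s = n - m]. *)
pose m := (Num.truncn (n%:R / L)).+1.
have nL0 : 0 <= n%:R / L by rewrite divr_ge0 ?ltW.
have /andP[mle mgt] := truncn_itv nL0.
have nL8 : n%:R / L <= n%:R / 8 by rewrite ler_pM2l // lef_pV2 ?posrE.
have mN : m%:R <= n%:R / L + 1 by rewrite /m -natr1 lerD2r.
have mn : (m < n)%N by rewrite -(ltr_nat R); lra.
pose s := (n - m)%N.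
have sE : s%:R = n%:R - m%:R :> R by rewrite natrB // ltnW.
have s_ge : n%:R / 2 + 2 <= s%:R :> R by rewrite sE; lra.
have s0 : 0 < s%:R - 1 :> R by lra.
have sn : (1 < s < n)%N.
  rewrite -!(ltr_nat R) sE; apply/andP; split; first by rewrite -sE; lra.
  by rewrite ltrBlDr ltrDl ltr0n.
apply: le_trans (tv_dist_ost0 R t sn).
have -> : n%:R - s%:R = m%:R :> R by rewrite sE subKr.
have y0 : 0 <= L - ln L - c.
  by rewrite -(pmulr_rge0 _ n0) (le_trans _ tn) ?ler0n.
have tL : t%:R <= n%:R * L.
  by rewrite (le_trans tn) // ler_pM2l //; lra.
(* Here [s >= n / 2] and [t <= n L] bound the exponent [8 t / (n s)] by [16 L / n]. *)
have rho : (1 + 8 / (n%:R * s%:R)) ^+ t <= expR (16 * (L / n%:R)).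
  apply: (@le_trans _ _ (expR (8 / (n%:R * s%:R)) ^+ t)).
    by rewrite lerXn2r ?nnegrE ?expR_ge0 ?expR_ge1Dx.
  rewrite -expRM_natl ler_expR.
  apply: (@le_trans _ _ ((n%:R * L) * (8 / (n%:R * s%:R)))).
    by rewrite ler_wpM2r // divr_ge0 // mulr_ge0 ?ler0n.
  have -> : n%:R * L * (8 / (n%:R * s%:R)) = 8 * L * s%:R^-1.
    by field; rewrite !gt_eqF //; lra.
  have -> : 16 * (L / n%:R) = 8 * L * (n%:R / 2)^-1 by field; rewrite gt_eqF.
  by rewrite ler_pM2l ?lef_pV2 ?posrE; lra.
have mdiv : m%:R / (2 * n%:R) <= L^-1.
  rewrite ler_pdivrMr; last by lra.
  have : 1 <= L^-1 * n%:R by rewrite mulrC ler_pdivlMr //; lra.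
  by rewrite [L^-1 * (2 * _)]mulrCA; rewrite mulrC in mN; lra.
(* With [y = L - ln L - c], the inverse of [1 - 1/s] is [1 + 1/(s - 1)], so its [t]-th power is at
   most [exp (t / (s - 1))], and [t / (s - 1) <= y + 2]. The 2 pays for replacing [n] by [s - 1], as
   [y (m + 1)] is at most about [n]. *)
have main : (m%:R * (1 - s%:R^-1) ^+ t)^-1 <= expR (2 - c).
  have expE : ((1 - s%:R^-1) ^+ t)^-1 = (1 + (s%:R - 1)^-1) ^+ t :> R.
    rewrite -exprVn; congr (_ ^+ _); field.
    by rewrite ?gt_eqF //; lra.
  rewrite invfM expE.
  have -> : expR (2 - c) = (n%:R / L)^-1 * expR (L - ln L - c + 2).
    rewrite (_ : L - _ - _ + _ = (2 - c) + (L - ln L)); last by ring.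
    rewrite (expRD (2 - c)) (expRB L) !lnK ?posrE //.
    by field; rewrite !gt_eqF.
  apply: ler_pM.
  - by rewrite invr_ge0 ler0n.
  - by rewrite exprn_ge0 // addr_ge0 // invr_ge0 ltW.
  - by rewrite lef_pV2 ?posrE ?ltr0n ?divr_gt0 // ltW.
  apply: (@le_trans _ _ (expR (s%:R - 1)^-1 ^+ t)).
    rewrite lerXn2r ?nnegrE ?expR_ge0 ?expR_ge1Dx //.
    by rewrite addr_ge0 // invr_ge0 ltW.
  rewrite -expRM_natl ler_expR ler_pdivrMr //.
  apply: (le_trans tn); move: y0; set y := L - ln L - c => y0.
  have yL : y <= L by rewrite /y; lra.
  have : y * (n%:R / L + 2) <= n%:R + 2 * L.
    apply: (@le_trans _ _ (L * (n%:R / L + 2))).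
      by rewrite ler_wpM2r // addr_ge0.
    by rewrite mulrDr mulrCA divff ?gt_eqF // mulr1 [L * 2]mulrC.
  have : y * m%:R <= y * (n%:R / L + 1) by rewrite ler_wpM2l.
  by rewrite sE; move: (n%:R / L) nL8 mN => q *; nra.
lra.
Qed.

(** The threshold on [n] is uniform in [T], so the same bound serves both the explicit time and the
    cutoff window. *)
Lemma near_tv_dist c e : 0 <= c -> 0 < e ->
  \forall n \near \oo, forall T,
    T <= n%:R * (ln n%:R - ln (ln n%:R) - c) ->
    1 - expR (2 - c) - e <= tv_dist (walk (@ost0 R n) T) (@unif R _).
Proof.
move=> c0 e0; pose d := ln (1 + e / 2) / 16.
have le0 : 0 < ln (1 + e / 2) by rewrite ln_gt0 // ltrDl divr_gt0.
have d0 : 0 < d by rewrite divr_gt0.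
near=> n => T Tn.
have L8 : 8 <= ln n%:R :> R by near: n; apply: near_ln_ge.
have Ln : ln n%:R <= 8^-1 * n%:R :> R by near: n; apply: near_ln_le.
have Le : 2 / e <= ln n%:R by near: n; apply: near_ln_ge.
have Lc : 2 * c <= ln n%:R by near: n; apply: near_ln_ge.
have Ld : ln n%:R <= d * n%:R by near: n; apply: near_ln_le.
have lnL : ln (ln n%:R) <= 2^-1 * ln n%:R :> R.
  by near: n; apply: near_lnln_le.
have L0 : 0 < ln n%:R :> R by lra.
have n0 : 0 < n%:R :> R by lra.
have tn : (Num.truncn T)%:R <= n%:R * (ln n%:R - ln (ln n%:R) - c).
  (* A negative [T] is truncated to 0, which still satisfies the bound. *)
  have [T0|T0] := lerP 0 T; first by rewrite (le_trans _ Tn) // truncn_le.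
  rewrite (_ : Num.truncn T = 0)%N ?mulr_ge0 ?ler0n //; first by lra.
  by apply/truncn0Pn; rewrite -ltNge (lt_trans T0).
apply: le_trans (tv_dist_ost0_log c0 L8 Ln tn).
have : expR (16 * (ln n%:R / n%:R)) <= 1 + e / 2.
  rewrite -[leRHS]lnK ?posrE; last by rewrite addr_gt0 // divr_gt0.
  rewrite ler_expR mulrC -ler_pdivlMr // -/d.
  by rewrite ler_pdivrMr.
have : (ln n%:R)^-1 <= e / 2.
  by rewrite -[e / 2]invrK invf_div lef_pV2 ?posrE ?divr_gt0.
lra.
Unshelve. all: by end_near.
Qed.

Lemma expR1_ge : 5 / 2 <= expR 1 :> R.
Proof.
have -> : 1 = 8%:R * 8^-1 :> R by rewrite divff // pnatr_eq0.
rewrite expRM_natl.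
apply: (@le_trans _ _ ((1 + 8^-1) ^+ 8)); first by lra.
by rewrite lerXn2r ?nnegrE ?expR_ge0 ?expR_ge1Dx // addr_ge0.
Qed.

(** The estimate [exp (x / 2) = e * exp (x / 2 - 1) >= (5 / 2) * (x / 2)] gives
    [exp x >= (25 / 16) x^2]. Already [pi >= 2] suffices, as [6 / 4 <= 25 / 16]. *)
Lemma expRN_le_pi x : 0 < x -> expR (- x) <= pi ^+ 2 / (6 * x ^+ 2).
Proof.
move=> x0; have ehalf : 5 / 4 * x <= expR (x / 2).
  have -> : x / 2 = 1 + (x / 2 - 1) by ring.
  rewrite expRD.
  apply: (@le_trans _ _ (5 / 2 * (1 + (x / 2 - 1)))); first by lra.
  apply: (@le_trans _ _ (5 / 2 * expR (x / 2 - 1))).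
    by rewrite ler_wpM2l ?expR_ge1Dx //; lra.
  by rewrite ler_wpM2r ?expR_ge0 ?expR1_ge.
have ex : 25 / 16 * x ^+ 2 <= expR x.
  have -> : expR x = expR (x / 2) ^+ 2.
    by rewrite -expRM_natl mulrC divfK // pnatr_eq0.
  have -> : 25 / 16 * x ^+ 2 = (5 / 4 * x) ^+ 2 by field.
  by rewrite lerXn2r ?nnegrE ?expR_ge0 // mulr_ge0 ?ltW.
have pi4 : 4 <= pi ^+ 2 :> R.
  by have := pi_ge2 R => p2; rewrite (_ : 4 = 2 ^+ 2) ?lerXn2r ?nnegrE; lra.
rewrite expRN ler_pdivlMr; last by rewrite mulr_gt0 // exprn_gt0.
by rewrite mulrC ler_pdivrMr ?expR_gt0 //; have := sqr_ge0 x; nra.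
Qed.

Lemma limn_esup_sep_dist c : 0 < c ->
  (limn_esup (fun n : nat =>
     (sep_dist (walk (@ost0 R n) (n%:R * ln n%:R + c * n%:R))
               (@unif R _))%:E) <= (expR (- c))%:E)%E.
Proof.
move=> c0; apply: limn_esup_le => e e0.
have le0 : 0 < ln (1 + e) by rewrite ln_gt0 // ltrDl.
near=> n.
have n1 : (0 < n)%N by near: n; apply: nbhs_infty_gt.
apply: (le_trans (sep_dist_walk_le n1 (ltW c0) (lexx _))).
have ni : n%:R^-1 <= ln (1 + e).
  rewrite -[leRHS]invrK lef_pV2 ?posrE ?invr_gt0 ?ltr0n //.
  by near: n; apply: nbhs_infty_ger.
have : expR n%:R^-1 <= 1 + e.
  by rewrite -[leRHS]lnK ?posrE ?addr_gt0 // ler_expR.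
rewrite expRD => /(ler_wpM2l (expR_ge0 (- c))) /le_trans; apply.
rewrite mulrDr mulr1 lerD2l ler_piMl ?(ltW e0) //.
by rewrite expR_le1 oppr_le0 ltW.
Unshelve. all: by end_near.
Qed.

Lemma limn_einf_tv_dist c : 2 < c ->
  ((1 - pi ^+ 2 / (6 * (c - 2) ^+ 2))%:E <=
   limn_einf (fun n : nat =>
     (tv_dist (walk (@ost0 R n)
                (n%:R * ln n%:R - n%:R * ln (ln n%:R) - c * n%:R))
              (@unif R _))%:E))%E.
Proof.
move=> c2; apply: limn_einf_ge => e e0.
have c0 : 0 <= c by lra.
apply: filterS (near_tv_dist c0 e0) => n h.
apply: le_trans (h _ _); last by rewrite !mulrBr [c * _]mulrC.
have cp : 0 < c - 2 by rewrite subr_gt0.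
by have := expRN_le_pi cp; rewrite opprB; lra.
Qed.

(** Treats both distances at once: the upper bound comes from separation and the lower one from
    total variation. *)
Lemma cutoff_ost0
    (dist : forall gT : finGroupType, (gT -> R) -> (gT -> R) -> R) :
  (forall (gT : finGroupType) (mu : gT -> R), \sum_g mu g = 1 ->
     tv_dist mu (@unif R _) <= dist gT mu (@unif R _)) ->
  (forall (gT : finGroupType) (mu : gT -> R), \sum_g mu g = 1 ->
     dist gT mu (@unif R _) <= sep_dist mu (@unif R _)) ->
  cutoff dist (fun n => @ost0 R n) (fun n => @unif R _)
    (fun n : nat => n%:R * ln n%:R).
Proof.
move=> tv_le le_sep.
have sum1 n T : (0 < n)%N -> \sum_g walk (@ost0 R n) T g = 1.
  by move=> n0; apply: sum_convpow; apply: ost0_sum.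
(* This window exceeds every multiple of [n], so the upper limit is 0 for each [c > 0] and the lower
   limit is 1 for each [c >= 2]: both functions of [c] are eventually constant. *)
exists (fun n => n%:R * ln (ln n%:R)); split.
- apply/eqoP => e e0; near=> n.
  have L1 : 1 <= ln n%:R :> R by near: n; apply: near_ln_ge.
  have lnL0 : 0 <= ln (ln n%:R) :> R by rewrite ln_ge0.
  rewrite !normrM mulrCA ler_wpM2l // !ger0_norm //; last by lra.
  by near: n; apply: near_lnln_le.
- apply: cvg_near_cst; near=> c.
  have c0 : 0 < c by near: c; apply: nbhs_pinfty_gt.
  apply/eqP; rewrite eq_le; apply/andP; split.
    apply: limn_esup_le => e e0; rewrite add0r; near=> n.
    have n0 : (0 < n)%N by near: n; apply: nbhs_infty_gt.
    apply: (le_trans (le_sep _ _ (sum1 _ _ n0))).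
    (* The 1 absorbs the error [1/n], and [exp (- 1/e) <= e]. *)
    pose b : R := e^-1 + 1.
    have b0 : 0 <= b by rewrite addr_ge0 // invr_ge0 ltW.
    have lnL : b / c <= ln (ln n%:R) by near: n; apply: near_lnln_ge.
    apply: (le_trans (sep_dist_walk_le n0 b0 _)).
      rewrite lerD2l [leRHS]mulrCA [leLHS]mulrC ler_wpM2l ?ler0n //.
      by rewrite mulrC -ler_pdivrMr.
    apply: (@le_trans _ _ (expR (- e^-1))).
      rewrite ler_expR /b opprD -addrA gerDl addrC subr_le0.
      by rewrite invf_le1 ?ltr0n // ler1n.
    rewrite expRN -[leRHS]invrK lef_pV2 ?posrE ?expR_gt0 ?invr_gt0 //.
    by apply: le_trans (expR_ge1Dx _); rewrite lerDr.
  apply: le_trans (limn_einf_sup _); apply: limn_einf_ge => e e0.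
  near=> n; have n0 : (0 < n)%N by near: n; apply: nbhs_infty_gt.
  rewrite sub0r (@le_trans _ _ 0) ?oppr_le0 ?(ltW e0) //.
  exact: le_trans (tv_dist_ge0 _ _) (tv_le _ _ (sum1 _ _ n0)).
- apply: cvg_near_cst; near=> c.
  have c2 : 2 <= c by near: c; apply: nbhs_pinfty_ge; rewrite num_real.
  apply/eqP; rewrite eq_le; apply/andP; split.
    apply: (le_trans (limn_einf_sup _)); apply: limn_esup_le => e e0.
    near=> n; have n0 : (0 < n)%N by near: n; apply: nbhs_infty_gt.
    apply: (le_trans (le_sep _ _ (sum1 _ _ n0))).
    rewrite (le_trans (sep_dist_le1 _)) ?lerDl ?ltW // => g.
    by apply: convpow_ge0; apply: ost0_ge0.
  apply: limn_einf_ge => e e0.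
  have e2 : 0 < e / 2 by rewrite divr_gt0.
  (* Chosen so that [exp (2 - b) <= e / 2]. *)
  pose b : R := 2 + (e / 2)^-1.
  have b0 : 0 <= b by rewrite addr_ge0 // invr_ge0 ltW.
  near=> n; have n0 : (0 < n)%N by near: n; apply: nbhs_infty_gt.
  apply: le_trans (tv_le _ _ (sum1 _ _ n0)).
  have lnL : b <= ln (ln n%:R) by near: n; apply: near_lnln_ge.
  have tvn : forall T, T <= n%:R * (ln n%:R - ln (ln n%:R) - b) ->
      1 - expR (2 - b) - e / 2 <= tv_dist (walk (@ost0 R n) T) (@unif R _).
    by near: n; apply: near_tv_dist.
  apply: le_trans (tvn _ _); last first.
    by rewrite mulrCA -mulrBr ler_wpM2l ?ler0n //; nra.
  suff : expR (2 - b) <= e / 2 by lra.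
  rewrite /b opprD addrA subrr add0r expRN.
  rewrite -[leRHS]invrK lef_pV2 ?posrE ?expR_gt0 ?invr_gt0 //.
  by apply: le_trans (expR_ge1Dx _); rewrite lerDr.
Unshelve. all: by end_near.
Qed.

End Asymptotics.

Theorem theorem4p4p10 (R : realType) :
  [/\ forall c1 : R, 0 < c1 ->
        (limn_esup (fun n : nat =>
           (sep_dist (walk (@ost0 R n) (n%:R * ln n%:R + c1 * n%:R))
                     (@unif R _))%:E)
         <= (expR (- c1))%:E)%E,
      forall c2 : R, 2 < c2 ->
        (limn_einf (fun n : nat =>
           (tv_dist (walk (@ost0 R n)
                       (n%:R * ln n%:R - n%:R * ln (ln n%:R) - c2 * n%:R))
                    (@unif R _))%:E)
         >= (1 - pi ^+ 2 / (6 * (c2 - 2) ^+ 2))%:E)%E,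
      cutoff (@tv_dist R) (fun n => @ost0 R n) (fun n => @unif R _)
        (fun n : nat => n%:R * ln n%:R)
    & cutoff (@sep_dist R) (fun n => @ost0 R n) (fun n => @unif R _)
        (fun n : nat => n%:R * ln n%:R)].
Proof.
split.
- exact: limn_esup_sep_dist.
- exact: limn_einf_tv_dist.
- by apply: cutoff_ost0 => // gT mu; apply: tv_le_sep.
- by apply: cutoff_ost0 => // gT mu; apply: tv_le_sep.
Qed.
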